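(* For all $0\le k\le n$, the generalised Koornwinder polynomials satisfy $$yH_{n,k}^{(a,b,c,d)}=\sum_{m=n-\deg\rho^2+1}^{n+1}l_{m,k+1}^{\,y,(n,k)}H_{m,k+1}^{(a,b,c,d)}+\sum_{m=n-1}^{n+\deg\rho^2-1}l_{m,k-1}^{\,y,(n,k)}H_{m,k-1}^{(a,b,c,d)}+\sum_{m=n-d_0}^{n+d_0}l_{m,k}^{\,y,(n,k)}H_{m,k}^{(a,b,c,d)},$$ where $$l_{m,k+1}^{\,y,(n,k)}=\delta_k^{(d,c)}\left(\mathcal T_{(a,b,c+d+2k+1)}^{(a,b,c+d+2k+3)}\right)_{[m-k-1,n-k]},\quad n-\deg\rho^2+1\le m\le n+1,$$ $$l_{m,k-1}^{\,y,(n,k)}=\delta_{k-1}^{(d,c)}\left(\mathcal T_{(a,b,c+d+2k-1)}^{(a,b,c+d+2k+1)}\right)_{[n-k,m-k+1]},\quad n-1\le m\le n+\deg\rho^2-1,$$ and, in case (i), $l_{m,k}^{\,y,(n,k)}=\gamma_k^{(d,c)}\left(\rho\big(J(w_R^{(a,b,c+d+2k+1)})\big)\right)_{[n-k,m-k]}$ for $n-d_0\le m\le n+d_0$, while in case (ii) $l_{m,k}^{\,y,(n,k)}=0$ (the third sum is absent). Consequently the matrix $J_y^{(a,b,c,d)}$, defined by $y\,\mathbf H^{(a,b,c,d)}=\mathbf H^{(a,b,c,d)}J_y^{(a,b,c,d)}$, has block-bandwidths $(\deg\rho^2-1,\deg\rho^2-1)$, each block has bandwidths $(1,1)$, and moreover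 $J_y^{(a,b,c,d)}$ is symmetric.
   Context: Setting. Let $\alpha<\beta$ and $\gamma<\delta$ be real, and let $\rho$ be a function on $[\alpha,\beta]$, positive on $(\alpha,\beta)$, with either: case (i), $\rho$ is a polynomial of degree $d_0$ (so $\deg\rho^2=2d_0$); or case (ii), $\rho$ is the square root of a polynomial of degree $d_1=\deg\rho^2$ and $\delta=-\gamma>0$. Put $\eta=0$ in case (i), $\eta=1$ in case (ii), so $d_\eta=\deg\rho^{1+\eta}$; assume $d_\eta\ge 2+\eta$. Let $\Omega=\{(x,y):\alpha\le x\le\beta,\ \gamma\rho(x)\le y\le\delta\rho(x)\}$. The parameters $a,b,c,d>-1$ are real, with $c=d$ in case (ii), and such that the weights below are integrable. Polynomials. $w_R^{(a,b,s)}(x)=(\beta-x)^a(x-\alpha)^b\rho(x)^s$ on $[\alpha,\beta]$, and $R_n^{(a,b,s)}$ ($n\ge0$) are the orthonormal polynomials (degree $n$, positive leading coefficient) for this weight; $\mathbf R^{(a,b,s)}=(R_0^{(a,b,s)},R_1^{(a,b,s)},\dots)$. $w_P^{(d,c)}(y)=(\delta-y)^d(y-\gamma)^c$ on $[\gamma,\delta]$, with orthonormal polynomials $\widetilde P_n^{(d,c)}$ (positive leading coefficient), which satisfy the three-term recurrence $$y\widetilde P_n^{(d,c)}=\delta_n^{(d,c)}\widetilde P_{n+1}^{(d,c)}+\gamma_n^{(d,c)}\widetilde P_n^{(d,c)}+\delta_{n-1}^{(d,c)}\widetilde P_{n-1}^{(d,c)},$$ which defines the coefficients $\delta_n^{(d,c)},\gamma_n^{(d,c)}$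 (not to be confused with the endpoints $\gamma,\delta$). The generalised Koornwinder polynomials are $$H_{n,k}^{(a,b,c,d)}(x,y)=R_{n-k}^{(a,b,c+d+2k+1)}(x)\,\rho(x)^k\,\widetilde P_k^{(d,c)}(y/\rho(x)),\quad 0\le k\le n,$$ orthonormal on $\Omega$ with respect to $W^{(a,b,c,d)}(x,y)=(\beta-x)^a(x-\alpha)^b(y-\gamma\rho(x))^c(\delta\rho(x)-y)^d$. $\mathbf H^{(a,b,c,d)}$ is the infinite row vector of all $H_{n,k}^{(a,b,c,d)}$, ordered in blocks $n=0,1,2,\dots$, block $n$ being $(H_{n,0},\dots,H_{n,n})$. Matrices. $J(w_R^{(a,b,s)})$ is the Jacobi matrix defined by $x\,\mathbf R^{(a,b,s)}=\mathbf R^{(a,b,s)}J(w_R^{(a,b,s)})$, and for a polynomial $f$, $f(J)$ is the usual matrix polynomial. $\mathcal T_{(a,b,s)}^{(a',b',s')}$ is the raising matrix defined by $\mathbf R^{(a,b,s)}=\mathbf R^{(a',b',s')}\mathcal T_{(a,b,s)}^{(a',b',s')}$. Conventions. $A_{[i,j]}$ is the entry in row $i+1$, column $j+1$ of $A$, and is $0$ if $i<0$ or $j<0$. Terms $H_{m,j}$ with indices outside $0\le j\le m$ are omitted (zero). A matrix has bandwidths $(\sigma,\mu)$ if $A_{[i,j]}=0$ whenever $i-j>\sigma$ or $j-i>\mu$; block-bandwidths are defined in the same way, with block $(i,j)$ (of size $(i+1)\times(j+1)$) in place of entry $[i,j]$, and ''each block has bandwidths'' refers to bandwidths within the blocks.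 *)

(* Defs.v *)
From HB Require Import structures.
From mathcomp Require Import all_boot all_order all_algebra.
From mathcomp Require Import all_classical all_reals all_analysis.

Set Implicit Arguments.
Unset Strict Implicit.
Unset Printing Implicit Defensive.

Import Order.TTheory GRing.Theory Num.Theory.
Import numFieldNormedType.Exports.
Local Open Scope classical_set_scope.
Local Open Scope ring_scope.

(* Infinite matrices, indexed from 0.  The sums \sum_(l \in [set: nat]) are
   finitely supported sums, so they are meaningful for column-finite matrices,
   which is the setting in which every product below is taken. *)
Section InfiniteMatrices.
Variable R : realType.

Definition imatrix := nat -> nat -> R.

Definition col_finite (A : imatrix) : Prop :=
  forall j, finite_set [set i | A i j != 0].

Definition imul (A B : imatrix) : imatrix :=
  fun i j => \sum_(l \in [set: nat]) (A i l * B l j).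

Definition iid : imatrix := fun i j => (i == j)%:R.

Definition ihorner (f : {poly R}) (A : imatrix) : imatrix :=
  fun i j => \sum_(t < size f) f`_t * iter t (imul A) iid i j.

(* The row vector (V_0, V_1, ...) times A. *)
Definition row_mul (V : lmodType R) (v : nat -> V) (A : imatrix) : nat -> V :=
  fun j => \sum_(i \in [set: nat]) (A i j *: v i).

Definition isymmetric (A : imatrix) : Prop := forall i j, A i j = A j i.

(* In the order (0,0), (1,0), (1,1), (2,0), ..., block n starts at position
   0 + 1 + ... + n. *)
Definition block_start (n : nat) : nat := 'C(n.+1, 2).

Definition iblock (A : imatrix) (i j : nat) : 'M[R]_(i.+1, j.+1) :=
  \matrix_(r < i.+1, s < j.+1) A (block_start i + r)%N (block_start j + s)%N.

Definition block_bandwidths (sigma mu : nat) (A : imatrix) : Prop :=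
  forall i j : nat, (sigma + j < i)%N || (mu + i < j)%N -> iblock A i j = 0.

Definition mx_bandwidths (sigma mu m n : nat) (B : 'M[R]_(m, n)) : Prop :=
  forall (r : 'I_m) (s : 'I_n),
    (sigma + s < r)%N || (mu + r < s)%N -> B r s = 0.

End InfiniteMatrices.

Section OrthogonalPolynomials.
Variable R : realType.

Definition orthonormal_polys (lo hi : R) (w : R -> R) (p : nat -> {poly R})
    : Prop :=
  (forall n, size (p n) = n.+1 /\ 0 < lead_coef (p n)) /\
  (forall m n, (\int[lebesgue_measure]_(x in `[lo, hi])
                  ((p m).[x] * (p n).[x] * w x)%:E = ((m == n)%:R)%:E)%E).

Definition jacobi_matrix (p : nat -> {poly R}) (J : imatrix R) : Prop :=
  col_finite J /\ forall n, 'X * p n = row_mul p J n.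

(* T is the raising matrix from p to p': p = p' T. *)
Definition raising_matrix (p p' : nat -> {poly R}) (T : imatrix R) : Prop :=
  col_finite T /\ forall n, p n = row_mul p' T n.

(* dl n and gm n are the coefficients written $\delta_n$, $\gamma_n$, with
   the term of index -1 absent. *)
Definition three_term (p : nat -> {poly R}) (dl gm : nat -> R) : Prop :=
  forall n, 'X * p n = dl n *: p n.+1 + gm n *: p n
                       + (if n is n'.+1 then dl n' *: p n' else 0).

End OrthogonalPolynomials.

Section Koornwinder.
Variable R : realType.

Definition wR (alpha beta : R) (rho : R -> R) (a b s x : R) : R :=
  (beta - x) `^ a * (x - alpha) `^ b * rho x `^ s.

Definition wP (gamma delta d c y : R) : R :=
  (delta - y) `^ d * (y - gamma) `^ c.

Definition Omega (alpha beta gamma delta : R) (rho : R -> R) : set (R * R) :=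
  [set z | alpha <= z.1 <= beta /\ gamma * rho z.1 <= z.2 <= delta * rho z.1].

Definition wW (alpha beta gamma delta : R) (rho : R -> R) (a b c d : R)
    (z : R * R) : R :=
  (beta - z.1) `^ a * (z.1 - alpha) `^ b
  * (z.2 - gamma * rho z.1) `^ c * (delta * rho z.1 - z.2) `^ d.

Definition kappa (c d : R) (k : nat) : R := c + d + (2 * k + 1)%:R.

(* Rp s n stands for $R_n^{(a,b,s)}$ and P k for $\widetilde P_k^{(d,c)}$.
   On Omega, rho x = 0 forces y = 0; the convention 0 / 0 = 0 then gives
   P_0 for k = 0 and 0 for k > 0, which is the value at that point of the
   polynomial rho(x)^k P_k(y / rho(x)) in y and rho(x). *)
Definition koornH (rho : R -> R) (c d : R) (Rp : R -> nat -> {poly R})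
    (P : nat -> {poly R}) (n k : nat) (x y : R) : R :=
  (Rp (kappa c d k) (n - k)%N).[x] * rho x ^+ k * (P k).[y / rho x].

Definition next_index (p : nat * nat) : nat * nat :=
  if (p.2 < p.1)%N then (p.1, p.2.+1) else (p.1.+1, 0%N).

(* Enumerates (0,0), (1,0), (1,1), (2,0), (2,1), (2,2), ... *)
Definition koorn_index (N : nat) : nat * nat := iter N next_index (0%N, 0%N).

Definition Hvec (rho : R -> R) (c d : R) (Rp : R -> nat -> {poly R})
    (P : nat -> {poly R}) (N : nat) (x y : R) : R :=
  koornH rho c d Rp P (koorn_index N).1 (koorn_index N).2 x y.

(* y h = h Jy as functions on the domain D. *)
Definition y_jacobi_matrix (D : set (R * R)) (h : nat -> R -> R -> R)
    (Jy : imatrix R) : Prop :=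
  col_finite Jy /\
  forall N x y, D (x, y) ->
    y * h N x y = \sum_(i \in [set: nat]) (Jy i N * h i x y).

End Koornwinder.

(* Main.v *)
Require Import Defs.
From HB Require Import structures.
From mathcomp Require Import all_boot all_order all_algebra.
From mathcomp Require Import all_classical all_reals all_analysis.
From mathcomp Require Import measurable_realfun.
From mathcomp Require Import zify ring lra.
Import Order.TTheory GRing.Theory Num.Theory.
Import numFieldNormedType.Exports.
Local Open Scope classical_set_scope.
Local Open Scope ring_scope.
Set Implicit Arguments.
Unset Strict Implicit.
Unset Printing Implicit Defensive.

(** With t = y / rho x one has y = rho x * t, so y * H_{n,k} is
    R_{n-k} * rho^(k+1) * (t * P_k t), and the three-term recurrence splits
    t * P_k t into multiples of P_(k+1) t, P_k t and P_(k-1) t.  Each of the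
    three pieces has to be brought back to the form R_i * rho^j * P_j t, where
    R_i must now be orthonormal for the weight w_j = w_R^(a, b, c+d+2j+1):

    - for j = k+1 the power of rho is right, and R_{n-k} is re-expanded in the
      next family: the coefficients are a column of the raising matrix;
    - for j = k-1 there is a spare factor rho^2, which is a polynomial Q on
      the interval, and Q * R_{n-k} is expanded in the previous family.  Since
      w_(j+1) = Q * w_j, multiplication by Q is adjoint to the change of basis,
      so these coefficients are a row of the same raising matrix
      ([connection_transpose_expansion]);
    - for j = k there is a spare factor rho.  If rho is a polynomial, its
      multiplication operator in the basis R is rho(J)
      ([ihorner_jacobi_entry]).  If rho is a square root, the weight of the
      P_k is even, hence P_k has the parity of k and the diagonal recurrence
      coefficients vanish ([even_three_term_diag_eq0]).

    The integrals enter only through the linear forms f |-> int f w_j on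
    polynomials, the relation w_(j+1) = Q * w_j between them and the invariance
    of the even one under reflection; the rest is linear algebra of a
    linear form L and polynomials p_n of degree n with L (p_m * p_n) = [m = n].
    The range of summation comes from degrees: L (f * p_n) = 0 as soon as
    deg f < n.

    Collecting the coefficients gives the matrix [y_matrix], whose
    entry formula is visibly symmetric, the up and down steps using the same
    raising matrix with the roles of row and column exchanged.  It is the only
    matrix of multiplication by y because the functions H_{n,k} are linearly
    independent on Omega ([Hvec_free]). *)

(** * Moment functionals of a weight *)

Section Moments.
Variable R : realType.
Implicit Types (p q : {poly R}) (w : R -> R) (lo hi : R).

Local Notation mu := (@lebesgue_measure R).

Definition moment lo hi w p : R := \int[mu]_(x in `[lo, hi]) (p.[x] * w x).

Lemma integrable_poly_weight lo hi w p :
  mu.-integrable `[lo, hi] (fun x => (w x)%:E) ->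
  mu.-integrable `[lo, hi] (fun x => (p.[x] * w x)%:E).
Proof.
move=> iw.
have mD : measurable (`[lo, hi]%classic : set R) by [].
have := @integrableMr _ _ _ mu _ mD (horner p) _ _ _ iw; apply.
  exact: measurable_poly.
have /compact_bounded : compact (horner p @` `[lo, hi]).
  apply: continuous_compact; last exact: segment_compact.
  exact/continuous_subspaceT/continuous_horner.
case=> M [Mr HM]; exists M; split => // x Mx z /= zi.
by apply: HM => //; exists z.
Qed.

Lemma moment_linear lo hi w :
  mu.-integrable `[lo, hi] (fun x => (w x)%:E) ->
  linear (moment lo hi w : {poly R} -> R^o).
Proof.
move=> iw c p q; rewrite /moment.
rewrite -[X in _ = X + _]/(c * Rintegral _ _ _) -RintegralZl//;
  last exact: integrable_poly_weight.
rewrite -RintegralD//; last 2 first.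
- have := integrable_poly_weight (c *: p) iw.
  by under [X in _.-integrable _ X -> _]eq_fun do rewrite hornerZ -mulrA.
- exact: integrable_poly_weight.
by apply: eq_Rintegral => x _; rewrite hornerD hornerZ mulrDl mulrA.
Qed.

(** Packages the moments as a linear map, so that the theory of linear maps
    applies to them below. *)
Lemma moment_linear_form lo hi w :
  mu.-integrable `[lo, hi] (fun x => (w x)%:E) ->
  {L : {linear {poly R} -> R^o} | forall p, L p = moment lo hi w p}.
Proof.
move=> /moment_linear lin.
pose m := GRing.isLinear.Build _ _ _ _ (moment lo hi w : {poly R} -> R^o) lin.
pose L : {linear {poly R} -> R^o} := HB.pack (moment lo hi w : {poly R} -> R^o) m.
by exists L.
Qed.

(** Endpoints are null sets.  The open interval is where rho is positive, so
    that its real powers add up; this gives the relation between two successive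
    weights there. *)
Lemma moment_mulr_weight lo hi w w' Q p :
  mu.-integrable `[lo, hi] (fun x => (w x)%:E) ->
  mu.-integrable `[lo, hi] (fun x => (w' x)%:E) ->
  (forall x, lo < x < hi -> w' x = Q.[x] * w x) ->
  moment lo hi w' p = moment lo hi w (Q * p).
Proof.
move=> iw iw' e; rewrite /moment /Rintegral; congr fine.
apply: eq_integral_itv_bounded.
- have /measurable_int /measurable_EFinP := integrable_poly_weight p iw'.
  by apply: measurable_funS => //; exact: subset_itv_oo_cc.
- have /measurable_int /measurable_EFinP := integrable_poly_weight (Q * p) iw.
  by apply: measurable_funS => //; exact: subset_itv_oo_cc.
- move=> x; rewrite in_itv /= => /e ->.
  by rewrite hornerM mulrCA !mulrA.
Qed.

(** The weight may be singular at the endpoints, so a change of variables for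
    continuous integrands does not apply; the reflection is carried out on
    Lebesgue measure itself, which is invariant under it. *)
Lemma moment_even hi w p :
  mu.-integrable `[- hi, hi] (fun x => (w x)%:E) ->
  (forall x, w (- x) = w x) ->
  moment (- hi) hi w (p \Po (- 'X)) = moment (- hi) hi w p.
Proof.
move=> iw ev; rewrite /moment /Rintegral; congr fine.
pose D : set R := `[- hi, hi]%classic.
have mD : measurable D by rewrite /D.
(* [integral_pushforward] wants an integrand measurable on the whole line,
   hence the restriction of f to D below. *)
pose N : measurableTypeR R -> measurableTypeR R := -%R.
have mN : measurable_fun setT N by exact: oppr_measurable.
have NdE : N @^-1` D = D by rewrite /D opp_preimage_itvbndbnd/= opprK.
have NDx x : D x -> D (N x) by rewrite -[D (N x)]/((N @^-1` D) x) NdE.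
pose f x := (p.[x] * w x)%:E.
have ip : mu.-integrable D f by exact: integrable_poly_weight.
have mf : measurable_fun [set: measurableTypeR R] (f \_ D).
  by apply/(measurable_restrictT _ mD); exact: measurable_int ip.
have iN : mu.-integrable (N @^-1` D) (f \_ D \o N).
  rewrite NdE; have := integrable_poly_weight (p \Po (- 'X)) iw.
  apply: eq_integrable => // x /set_mem xD /=.
  by rewrite patchE ifT ?inE; [rewrite /f horner_comp !hornerE ev|exact: NDx].
have pf := integral_pushforward mN mf iN mD; rewrite NdE in pf.
transitivity (\int[mu]_(x in D) ((f \_ D) \o N) x)%E.
  apply: eq_integral => x /set_mem xD /=.
  by rewrite patchE ifT ?inE; [rewrite /f horner_comp !hornerE ev|exact: NDx].
rewrite -pf; transitivity (\int[mu]_(x in D) (f \_ D) x)%E.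
  by apply: eq_measure_integral => A mA _; exact: lebesgue_measureN.
by apply: eq_integral => x xD; rewrite patchE xD.
Qed.

End Moments.

(** * Finitely supported sums over the natural numbers *)

Section FiniteSupport.
Variable V : nmodType.

Lemma fsbig_nat_ord (F : nat -> V) N :
  (forall i, (N <= i)%N -> F i = 0) ->
  \sum_(i \in [set: nat]) F i = \sum_(i < N) F i.
Proof.
move=> F0; rewrite fsbig_ord; apply/esym/fsbig_widen => // i [_ /=] /negP.
by rewrite -leqNgt; exact: F0.
Qed.

Lemma finite_support_bound (F : nat -> V) :
  finite_set [set i | F i != 0] -> exists N, forall i, (N <= i)%N -> F i = 0.
Proof.
move=> /finite_seqP[s /seteqP[Fs _]]; exists (\max_(i <- s) i).+1 => i Ni.
apply/eqP; apply: contraTT Ni => Fi0; rewrite -ltnNge ltnS.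
by apply: leq_bigmax_seq => //; exact: Fs.
Qed.

Lemma bound_finite_support (F : nat -> V) N :
  (forall i, (N <= i)%N -> F i = 0) -> finite_set [set i | F i != 0].
Proof.
move=> F0; apply: sub_finite_set (finite_II N) => i /= Fi0.
by rewrite ltnNge; apply: contra Fi0 => /F0 ->.
Qed.

Lemma big_nat_support (F : nat -> V) (Pr : pred nat) lo hi M : (hi <= M)%N ->
  (forall m, Pr m -> (m < lo)%N || (hi <= m)%N -> F m = 0) ->
  \sum_(0 <= m < M | Pr m) F m = \sum_(lo <= m < hi | Pr m) F m.
Proof.
move=> hiM F0; rewrite [RHS](big_nat_widen _ _ M) //; have [loM|Mlo] := leqP lo M.
  rewrite [RHS](big_nat_widenl lo 0) // [LHS]big_mkcond [RHS]big_mkcond /=.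
  apply: eq_big_nat => m _; case Pm : (Pr m) => //=.
  case: ifP => //= /negbT; rewrite negb_and -leqNgt -ltnNge => h.
  by apply: F0 => //; rewrite orbC.
rewrite [RHS]big_geq; last exact: ltnW.
rewrite big_nat_cond big1// => m /andP[/andP[_ mM] Pm]; apply: F0 => //.
by rewrite (ltn_trans mM Mlo).
Qed.

Lemma big_nat_shift (F : nat -> V) s M :
  \sum_(0 <= m < M | (s <= m)%N) F m = \sum_(i < M - s) F (i + s)%N.
Proof.
have [sM|Ms] := leqP s M.
  rewrite -(big_nat_widenl s 0 M xpredT) // -{1}(add0n s) big_addn big_mkord.
  by [].
rewrite (eqP (ltnW Ms : (M <= s)%N)) big_ord0 big_nat_cond big1 // => m.
by move=> /andP[/andP[_ mM]]; rewrite leqNgt (ltn_trans mM Ms).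
Qed.

Lemma big_triangle (F : nat -> nat -> V) M :
  \sum_(m < M) \sum_(j < m.+1) F m j
    = \sum_(j < M) \sum_(0 <= m < M | (j <= m)%N) F m j.
Proof.
rewrite [RHS](eq_bigr (fun j : 'I_M => \sum_(m < M | (j <= m)%N) F m j)); last first.
  by move=> j _; rewrite big_mkord.
rewrite (exchange_big_dep xpredT) //=; apply: eq_bigr => m _.
rewrite -(big_ord_narrow (ltn_ord m) (F := F m)).
by apply: eq_bigl => j; rewrite ltnS.
Qed.

Lemma big_ord_delta (F : nat -> V) M s : (s < M)%N ->
  \sum_(j < M) (if j == s :> nat then F j else 0) = F s.
Proof.
move=> sM; rewrite (bigD1 (Ordinal sM)) //= eqxx big1 ?addr0 // => j.
by rewrite -val_eqE /= => /negbTE ->.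
Qed.

End FiniteSupport.

(** * Expansions in polynomials orthonormal for a linear form *)

Section OrthonormalExpansion.
Variables (R : realType) (L : {linear {poly R} -> R^o}) (p : nat -> {poly R}).
Hypothesis size_p : forall n, size (p n) = n.+1.
Hypothesis ortho_p : forall m n, L (p m * p n) = (m == n)%:R.

Lemma orthonormal_span N (f : {poly R}) : (size f <= N)%N ->
  exists c : nat -> R, f = \sum_(i < N) c i *: p i.
Proof.
elim: N f => [|N IH] f.
  by rewrite leqn0 size_poly_eq0 => /eqP ->; exists (fun=> 0); rewrite big_ord0.
move=> fN; have lc0 : lead_coef (p N) != 0.
  by rewrite lead_coef_eq0 -size_poly_eq0 size_p.
pose g := f - (f`_N / lead_coef (p N)) *: p N.
have [|c gE] := IH g.
  apply/leq_sizeP => j; rewrite leq_eqVlt => /predU1P[<-|Nj].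
    rewrite /g coefB coefZ lead_coefE size_p /= divfK ?subrr //.
    by rewrite lead_coefE size_p in lc0.
  rewrite /g coefB coefZ (nth_default _ (leq_trans fN Nj)).
  by rewrite [(p N)`_j]nth_default ?mulr0 ?subrr ?size_p.
exists (fun i => if i == N then f`_N / lead_coef (p N) else c i).
rewrite big_ord_recr /= eqxx (eq_bigr (fun i : 'I_N => c i *: p i)).
  by rewrite -gE /g subrK.
by move=> i _; rewrite (ltn_eqF (ltn_ord i)).
Qed.

Lemma orthonormal_coef N (c : nat -> R) i :
  L ((\sum_(j < N) c j *: p j) * p i) = if (i < N)%N then c i else 0.
Proof.
rewrite mulr_suml linear_sum /=.
under eq_bigr do rewrite -scalerAl linearZ /= ortho_p.
have [iN|Ni] := ltnP i N.
  rewrite (bigD1 (Ordinal iN)) //= eqxx big1 ?addr0; first exact: mulr1.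
  by move=> j /negbTE; rewrite -val_eqE /= => ->; exact: mulr0.
rewrite big1 // => j _; rewrite (ltn_eqF (leq_trans (ltn_ord j) Ni)).
exact: mulr0.
Qed.

Lemma orthonormal_expansion N (f : {poly R}) : (size f <= N)%N ->
  f = \sum_(i < N) L (f * p i) *: p i.
Proof.
move=> /orthonormal_span[c fE]; rewrite {1}fE; apply: eq_bigr => i _.
by rewrite fE orthonormal_coef ltn_ord.
Qed.

Lemma orthonormal_low_degree n (f : {poly R}) : (size f <= n)%N -> L (f * p n) = 0.
Proof.
by move=> /orthonormal_span[c ->]; rewrite orthonormal_coef ltnn.
Qed.

Lemma orthonormal_parseval N (f g : {poly R}) : (size f <= N)%N ->
  L (f * g) = \sum_(i < N) L (f * p i) * L (g * p i).
Proof.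
move=> /orthonormal_expansion fE; rewrite {1}fE mulr_suml linear_sum.
by apply: eq_bigr => i _; rewrite -scalerAl linearZ /= [p i * g]mulrC.
Qed.

(** A column-finite matrix expressing a family in the basis p is determined by
    the linear form; this identifies the raising and Jacobi matrices, which are
    given only by the equation that they satisfy. *)
Lemma row_mul_coef (A : imatrix R) j (f : {poly R}) : col_finite A ->
  f = Defs.row_mul p A j -> forall i, A i j = L (f * p i).
Proof.
move=> /(_ j)/finite_support_bound[N A0] fE i.
rewrite fE /Defs.row_mul (@fsbig_nat_ord _ _ N); last first.
  by move=> l /A0 ->; rewrite scale0r.
by rewrite (orthonormal_coef _ (A^~ j)); case: ltnP => // /A0.
Qed.

End OrthonormalExpansion.

Lemma size_polyM_leq (R : nzRingType) (f g : {poly R}) m n :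
  (size f <= m.+1)%N -> (size g <= n)%N -> (size (f * g)%R <= m + n)%N.
Proof.
move=> fm gn; rewrite (leq_trans (size_polyMleq _ _)) // -subn1 leq_subLR.
by rewrite (leq_trans (leq_add fm gn)).
Qed.

(** * The matrix of multiplication by a polynomial *)

Section MultiplicationMatrix.
Variables (R : realType) (L : {linear {poly R} -> R^o}) (p : nat -> {poly R}).
Hypothesis size_p : forall n, size (p n) = n.+1.
Hypothesis ortho_p : forall m n, L (p m * p n) = (m == n)%:R.

Definition mult_entry (u : {poly R}) i j : R := L (u * p j * p i).

Lemma mult_entry_sym u i j : mult_entry u i j = mult_entry u j i.
Proof. by rewrite /mult_entry -!mulrA [p j * _]mulrC. Qed.

(** The first alternative is a degree count, the second follows by symmetry. *)
Lemma mult_entry_eq0 (u : {poly R}) du i j : (size u <= du.+1)%N ->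
  (j + du < i)%N || (i + du < j)%N -> mult_entry u i j = 0.
Proof.
move=> su; have low a b : (a + du < b)%N -> mult_entry u b a = 0.
  move=> ab; rewrite /mult_entry (orthonormal_low_degree size_p ortho_p) //.
  by rewrite (leq_trans (size_polyM_leq su (leqnn _))) // size_p; lia.
by case/orP => /low // ij0; rewrite mult_entry_sym.
Qed.

Lemma mult_entry_expansion (u : {poly R}) du j N : (size u <= du.+1)%N -> (j + du < N)%N ->
  u * p j = \sum_(i < N) mult_entry u i j *: p i.
Proof.
move=> su jN; apply: (orthonormal_expansion size_p ortho_p).
by rewrite (leq_trans (size_polyM_leq su (leqnn _))) // size_p; lia.
Qed.

(** Parseval's identity for u * p i and v * p j, the sum being finite because
    u * p i has finite degree. *)
Lemma mult_entryM (u v : {poly R}) du i j N : (size u <= du.+1)%N -> (i + du < N)%N ->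
  mult_entry (u * v) i j = \sum_(l < N) mult_entry u i l * mult_entry v l j.
Proof.
move=> su iN; rewrite {1}/mult_entry (_ : _ * p i = u * p i * (v * p j)); last by ring.
rewrite (orthonormal_parseval size_p ortho_p (N := N)).
  by apply: eq_bigr => l _; rewrite (mult_entry_sym u).
by rewrite (leq_trans (size_polyM_leq su (leqnn _))) // size_p; lia.
Qed.

Section Jacobi.
Variable J : imatrix R.
Hypothesis jacobi_J : jacobi_matrix p J.

Lemma jacobi_entry i j : J i j = mult_entry 'X i j.
Proof. by case: jacobi_J => fJ /(_ j)/(row_mul_coef ortho_p fJ)/(_ i). Qed.

Lemma jacobi_power_entry t i j :
  iter t (imul J) (@iid R) i j = mult_entry 'X^t i j.
Proof.
elim: t i j => [|t IH] i j.
  by rewrite /mult_entry expr0 mul1r ortho_p /= /iid eq_sym.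
rewrite iterS /imul (@fsbig_nat_ord _ _ i.+2); last first.
  by move=> l il; rewrite jacobi_entry (@mult_entry_eq0 _ 1) ?mul0r ?size_polyX //; lia.
rewrite exprS (@mult_entryM _ _ 1 _ _ i.+2) ?size_polyX ?addn1 //.
by apply: eq_bigr => l _; rewrite IH jacobi_entry.
Qed.

Lemma ihorner_jacobi_entry (f : {poly R}) i j :
  ihorner f J i j = mult_entry f i j.
Proof.
rewrite /ihorner /mult_entry -[in RHS](coefK f) poly_def !mulr_suml linear_sum.
apply: eq_bigr => t _.
by rewrite jacobi_power_entry -!scalerAl linearZ.
Qed.

End Jacobi.

End MultiplicationMatrix.

(** * Change of basis between the weights w and Q w *)

Section ConnectionMatrix.
Variables (R : realType) (L L' : {linear {poly R} -> R^o}).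
Variables (p p' : nat -> {poly R}) (Q : {poly R}) (D : nat).
Hypothesis size_p : forall n, size (p n) = n.+1.
Hypothesis ortho_p : forall m n, L (p m * p n) = (m == n)%:R.
Hypothesis size_p' : forall n, size (p' n) = n.+1.
Hypothesis ortho_p' : forall m n, L' (p' m * p' n) = (m == n)%:R.
Hypothesis L'E : forall f, L' f = L (Q * f).
Hypothesis size_Q : (size Q <= D.+1)%N.

Definition connection_entry i j : R := L' (p j * p' i).

Lemma raising_matrix_entry (T : imatrix R) i j :
  raising_matrix p p' T -> T i j = connection_entry i j.
Proof. by case=> fT /(_ j)/(row_mul_coef ortho_p' fT)/(_ i). Qed.

(** Above the diagonal band the polynomial Q is moved over to [p' i], which
    makes the degree count possible in the family p. *)
Lemma connection_entry_eq0 i j :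
  (j < i)%N || (i + D < j)%N -> connection_entry i j = 0.
Proof.
rewrite /connection_entry => /orP[ji|ij].
  by rewrite (orthonormal_low_degree size_p' ortho_p') // size_p.
rewrite L'E (_ : Q * _ = Q * p' i * p j); last by ring.
rewrite (orthonormal_low_degree size_p ortho_p) //.
by rewrite (leq_trans (size_polyM_leq size_Q (leqnn _))) // size_p'; lia.
Qed.

Lemma connection_expansion j N : (j < N)%N ->
  p j = \sum_(i < N) connection_entry i j *: p' i.
Proof.
by move=> jN; apply: (orthonormal_expansion size_p' ortho_p'); rewrite size_p.
Qed.

(** L (Q * p' j * p i) = L' (p' j * p i): multiplication by Q from the basis p'
    to the basis p is the adjoint of the inclusion of p into p', hence the
    transposed indices. *)
Lemma connection_transpose_expansion j N : (j + D < N)%N ->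
  Q * p' j = \sum_(i < N) connection_entry j i *: p i.
Proof.
move=> jN; rewrite (orthonormal_expansion size_p ortho_p (f := Q * p' j) (N := N)).
  by apply: eq_bigr => i _; rewrite /connection_entry L'E; congr (L _ *: _); ring.
by rewrite (leq_trans (size_polyM_leq size_Q (leqnn _))) // size_p'; lia.
Qed.

End ConnectionMatrix.

(** * Recurrence coefficients of an even weight *)

Section EvenWeight.
Variables (R : realType) (L : {linear {poly R} -> R^o}) (p : nat -> {poly R}).
Hypothesis size_p : forall n, size (p n) = n.+1.
Hypothesis ortho_p : forall m n, L (p m * p n) = (m == n)%:R.
Hypothesis even_L : forall f, L (f \Po (- 'X)) = L f.
Variables (dl gm : nat -> R).
Hypothesis ttr : three_term p dl gm.

Lemma three_term_diag n : gm n = L ('X * p n * p n).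
Proof.
rewrite ttr !mulrDl !linearD /= -!scalerAl !linearZ /= !ortho_p.
rewrite (gtn_eqF (ltnSn n)) eqxx -[LHS]mulr1.
suff -> : L ((if n is n'.+1 then dl n' *: p n' else 0) * p n) = 0.
  by rewrite addr0 [X in _ = X + _]mulr0 add0r.
case: n => [|n]; first by rewrite mul0r linear0.
by rewrite -scalerAl linearZ /= ortho_p (ltn_eqF (ltnSn n)); exact: mulr0.
Qed.

Lemma three_term_offdiag_neq0 n : dl n != 0.
Proof.
apply/eqP => d0; have := ttr n; rewrite d0 scale0r add0r => /(congr1 (size \o val)) /=.
rewrite mulrC size_mulX ?size_p -?size_poly_eq0 ?size_p // => e.
suff : (n.+2 <= n.+1)%N by rewrite ltnn.
rewrite {1}e (leq_trans (size_polyD _ _)) // geq_max.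
rewrite (leq_trans (size_scale_leq _ _)) ?size_p //.
case: n {d0 e} => [|n]; first by rewrite size_poly0.
by rewrite (leq_trans (size_scale_leq _ _)) ?size_p.
Qed.

(** The diagonal coefficient is L (X * (p n)^2), the moment of an odd polynomial. *)
Lemma parity_diag_eq0 n : p n \Po (- 'X) = (-1) ^+ n *: p n ->
  gm n = 0.
Proof.
move=> par; rewrite three_term_diag; set f := _ * _.
have fN : f \Po (- 'X) = - f.
  rewrite /f !comp_polyM comp_polyX par -!scalerAr -!scalerAl scalerA.
  by rewrite -exprMn mulrNN mulr1 expr1n scale1r !mulNr.
have := even_L f; rewrite fN linearN => /eqP.
by rewrite -subr_eq0 -opprD oppr_eq0 -mulr2n mulrn_eq0 /= => /eqP.
Qed.

(** Parity propagates along the recurrence once the diagonal coefficient is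
    known to vanish, so that the two facts are proved together; the recurrence
    has two steps of memory, whence the pair of consecutive indices. *)
Lemma even_three_term_diag_eq0 n : gm n = 0.
Proof.
apply: parity_diag_eq0.
suff [] : p n \Po (- 'X) = (-1) ^+ n *: p n /\
          p n.+1 \Po (- 'X) = (-1) ^+ n.+1 *: p n.+1 by [].
have step m : p m \Po (- 'X) = (-1) ^+ m *: p m ->
    (if m is m'.+1 then dl m' *: p m' else 0) \Po (- 'X) =
      (-1) ^+ m.+1 *: (if m is m'.+1 then dl m' *: p m' else 0) ->
    p m.+1 \Po (- 'X) = (-1) ^+ m.+1 *: p m.+1.
  move=> par parm; have := ttr m.
  rewrite (parity_diag_eq0 par) scale0r addr0 => tE.
  have {tE} pE := canLR (addrK _) tE.
  apply: (scalerI (three_term_offdiag_neq0 m)).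
  rewrite -comp_polyZ scalerA [dl m * _]mulrC -scalerA -pE comp_polyB comp_polyM.
  by rewrite comp_polyX par parm scalerBr exprS mulN1r -scalerAr mulNr !(scaleNr, scalerN).
elim: n => [|n [IH IH']].
  have p0 : p 0%N \Po (- 'X) = (-1) ^+ 0 *: p 0%N.
    have /size_poly1P[c _ ->] : size (p 0%N) == 1%N by rewrite size_p.
    by rewrite comp_polyC scale1r.
  by split=> //; apply: step => //=; rewrite comp_polyC scaler0.
split=> //; apply: step => //=.
by rewrite comp_polyZ IH !exprS mulrA mulrNN !mul1r !scalerA mulrC.
Qed.

End EvenWeight.

(** * The enumeration of the pairs (n, k) *)

Section BlockIndex.

Lemma block_startS n : block_start n.+1 = (block_start n + n.+1)%N.
Proof. by rewrite /block_start binS bin1. Qed.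

Lemma leq_block_start n : (n <= block_start n)%N.
Proof. by elim: n => // n _; rewrite block_startS; lia. Qed.

Lemma koorn_index_block n r : (r <= n)%N ->
  koorn_index (block_start n + r) = (n, r).
Proof.
have step m s : (s <= m)%N -> koorn_index (block_start m) = (m, 0%N) ->
    koorn_index (block_start m + s) = (m, s).
  move=> + m0; elim: s => [|s IH] sm; first by rewrite addn0.
  by rewrite addnS /koorn_index iterS -/(koorn_index _) IH ?(ltnW sm) // /next_index sm.
move=> rn; apply: (step) => //; elim: n {r rn} => // n IH.
rewrite block_startS addnS /koorn_index iterS -/(koorn_index _) step //.
by rewrite /next_index ltnn.
Qed.

Lemma koorn_index_decode N :
  exists n r, [/\ (r <= n)%N, N = (block_start n + r)%N & koorn_index N = (n, r)].
Proof.
suff [n [r [rn ->]]] : exists n r, (r <= n)%N /\ N = (block_start n + r)%N.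
  by exists n, r; rewrite koorn_index_block.
elim: N => [|N [n [r [rn ->]]]]; first by exists 0%N, 0%N.
move: rn; rewrite leq_eqVlt => /predU1P[->|rn].
  by exists n.+1, 0%N; rewrite block_startS addn0 addnS.
by exists n, r.+1; rewrite addnS.
Qed.

Lemma koorn_index_le N : ((koorn_index N).2 <= (koorn_index N).1)%N.
Proof. by have [n [r [rn _ ->]]] := koorn_index_decode N. Qed.

Lemma koorn_index_large M N : (block_start M <= N)%N ->
  (M <= (koorn_index N).1)%N.
Proof.
have [n [r [rn -> ->]]] := koorn_index_decode N => /=; apply: contraTT.
rewrite -!ltnNge => nM; suff : (block_start n.+1 <= block_start M)%N.
  by rewrite block_startS; lia.
elim: M nM => // M IH; rewrite ltnS leq_eqVlt => /predU1P[->//|/IH].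
by rewrite (block_startS M); lia.
Qed.

Lemma big_koorn_index (V : nmodType) (F : nat -> nat -> V) M :
  \sum_(i < block_start M) F (koorn_index i).1 (koorn_index i).2
    = \sum_(j < M) \sum_(0 <= m < M | (j <= m)%N) F m j.
Proof.
rewrite -big_triangle; elim: M => [|M IH]; first by rewrite !big_ord0.
rewrite big_ord_recr -IH block_startS big_split_ord /=; congr (_ + _).
apply: eq_bigr => r _.
by rewrite koorn_index_block // -ltnS.
Qed.

End BlockIndex.

(** * Polynomials on an interval *)

Section PolynomialIdentities.
Variable R : realFieldType.

Lemma graded_free (p : nat -> {poly R}) N (c : nat -> R) :
  (forall n, size (p n) = n.+1) -> \sum_(i < N) c i *: p i = 0 ->
  forall i, (i < N)%N -> c i = 0.
Proof.
move=> sp; elim: N => // N IH; rewrite big_ord_recr /= => s0.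
have cN : c N = 0.
  move/(congr1 (coefp N)): s0; rewrite /= coefD coefZ coef_sum coef0.
  rewrite big1 => [|i _]; last first.
    by rewrite coefZ nth_default ?mulr0 // sp ltn_ord.
  move/eqP; rewrite add0r mulf_eq0 => /orP[/eqP//|].
  have : lead_coef (p N) != 0 by rewrite lead_coef_eq0 -size_poly_eq0 sp.
  by rewrite lead_coefE sp => /negbTE ->.
move=> i; rewrite ltnS leq_eqVlt => /predU1P[->//|].
by apply: IH; move: s0; rewrite cN scale0r addr0.
Qed.

Lemma poly_itv_eq0 (p : {poly R}) lo hi : lo < hi ->
  (forall x, lo < x < hi -> p.[x] = 0) -> p = 0.
Proof.
move=> lohi p0.
pose s := [seq lo + (hi - lo) / i.+2%:R | i <- iota 0 (size p)].
apply: (@roots_geq_poly_eq0 _ p s); last by rewrite size_map size_iota.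
  apply/allP => _ /mapP[i _ ->]; apply/rootP/p0.
  have d0 : 0 < hi - lo by rewrite subr_gt0.
  rewrite ltrDl divr_gt0 ?ltr0n //= -ltrBrDl ltr_pdivrMr ?ltr0n //.
  by rewrite ltr_pMr // ltr1n.
rewrite map_inj_uniq ?iota_uniq // => i j /addrI /mulfI.
rewrite subr_eq0 gt_eqF // => /(_ isT) /invr_inj /eqP.
by rewrite eqr_nat => /eqP [].
Qed.

End PolynomialIdentities.

(** A negative value at an endpoint would force a zero in the interior. *)
Lemma poly_ge0_closed_itv (R : rcfType) (p : {poly R}) lo hi : lo < hi ->
  (forall x, lo < x < hi -> 0 < p.[x]) -> forall x, lo <= x <= hi -> 0 <= p.[x].
Proof.
move=> lohi p0 x /andP[lox xhi]; rewrite leNgt; apply/negP => px.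
pose m := (lo + hi) / 2%:R.
have [lom mhi] : lo < m /\ m < hi by rewrite /m; split; lra.
have pm : 0 < p.[m] by apply: p0; rewrite lom.
have [xm|mx] := leP x m.
  have [|z /andP[xz zm] /rootP z0] := @poly_ivt _ p x m xm; first by rewrite !ltW.
  have xz' : x < z.
    by rewrite lt_neqAle xz andbT; apply: contraTneq px => ->; rewrite z0 ltxx.
  by have := p0 z; rewrite z0 ltxx (le_lt_trans lox xz') (le_lt_trans zm mhi) => /(_ isT).
have [|z /andP[mz zx] /rootP] := @poly_ivt _ (- p) m x (ltW mx).
  by rewrite !hornerN oppr_le0 oppr_ge0 !ltW.
rewrite hornerN => /eqP; rewrite oppr_eq0 => /eqP z0.
have zx' : z < x.
  by rewrite lt_neqAle zx andbT; apply: contraTneq px => <-; rewrite z0 ltxx.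
by have := p0 z; rewrite z0 ltxx (lt_le_trans lom mz) (lt_le_trans zx' xhi) => /(_ isT).
Qed.

(** * Linear independence of the Koornwinder functions *)

Section KoornwinderFunctions.
Variables (R : realType) (alpha beta gamma delta : R) (rho : R -> R) (c d : R).
Variables (Rp : R -> nat -> {poly R}) (P : nat -> {poly R}).

Local Notation r k := (Rp (kappa c d k)).
Local Notation Om := (Omega alpha beta gamma delta rho).
Local Notation H := (koornH rho c d Rp P).
Local Notation h := (Hvec rho c d Rp P).

(** Where rho vanishes, the slice of Omega is reduced to y = 0, and both sides
    are 0 by the convention on division by 0. *)
Lemma Omega_mul_ratio x y : Om (x, y) -> y = rho x * (y / rho x).
Proof.
case=> /= _ yb; have [r0|r0] := eqVneq (rho x) 0.
  by move: yb; rewrite r0 !mulr0 mul0r => /le_anti.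
by rewrite mulrC divfK.
Qed.

(** All the functions of the same order s share the factor rho^s * P_s. *)
Lemma koornH_sum (e : nat -> R) s M x y :
  \sum_(0 <= m < M | (s <= m)%N) e m * H m s x y
    = (\sum_(i < M - s) e (i + s)%N * (r s i).[x]) * (rho x ^+ s * (P s).[y / rho x]).
Proof.
rewrite big_nat_shift mulr_suml; apply: eq_bigr => i _.
by rewrite /koornH addnK; ring.
Qed.

Hypothesis lt_alpha_beta : alpha < beta.
Hypothesis lt_gamma_delta : gamma < delta.
Hypothesis rho_gt0 : forall x, alpha < x < beta -> 0 < rho x.
Hypothesis size_r : forall k n, size (r k n) = n.+1.
Hypothesis size_P : forall n, size (P n) = n.+1.

(** For fixed x in the open interval, t = y / rho x runs over the whole interval
    from gamma to delta, so the independence of the P_j separates the orders j;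
    for fixed j, the independence of the R_i over x finishes the proof. *)
Lemma Hvec_free N (A : nat -> R) :
  (forall x y, Om (x, y) -> \sum_(i < N) A i * h i x y = 0) ->
  forall i, (i < N)%N -> A i = 0.
Proof.
move=> A0; pose B i := if (i < N)%N then A i else 0.
(* Extending A by 0 makes the sum run over complete blocks: N entries lie
   within the first N blocks. *)
suff B0 j i : (j < N)%N -> (i < N - j)%N -> B (block_start (i + j) + j)%N = 0.
  move=> l lN; have [n [s [sn lE _]]] := koorn_index_decode l.
  have nl : (n <= l)%N by rewrite lE; have := leq_block_start n; lia.
  have := B0 s (n - s)%N; rewrite subnK // -lE /B lN; apply; lia.
move=> jN iN; pose C j i := B (block_start (i + j) + j)%N.
have S0 x : alpha < x < beta -> forall s, (s < N)%N ->
    \sum_(l < N - s) C s l * (r s l).[x] = 0.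
  move=> xI s sN; have rx := rho_gt0 xI.
  pose S s := \sum_(l < N - s) C s l * (r s l).[x].
  have : \sum_(s < N) (S s * rho x ^+ s) *: P s = 0.
    apply: (poly_itv_eq0 lt_gamma_delta) => t /andP[gt td].
    have xyO : Om (x, rho x * t).
      split=> /=; first by case/andP: xI => /ltW -> /ltW ->.
      by rewrite [gamma * _]mulrC [delta * _]mulrC !ler_pM2l // (ltW gt) ltW.
    rewrite horner_sum -[RHS](A0 _ _ xyO).
    transitivity (\sum_(l < block_start N) B l * h l x (rho x * t)); last first.
      rewrite [RHS](big_ord_widen _ (fun l => A l * h l x (rho x * t)) (leq_block_start N)).
      rewrite [RHS]big_mkcond; apply: eq_bigr => l _.
      by rewrite /B; case: ifP => //; rewrite mul0r.
    pose F m j := B (block_start m + j)%N * H m j x (rho x * t).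
    transitivity (\sum_(l < block_start N) F (koorn_index l).1 (koorn_index l).2);
      last first.
      apply: eq_bigr => l _; rewrite /Hvec /F.
      by have [n [s' [_ lE ->]]] := koorn_index_decode l; rewrite /= -lE.
    rewrite big_koorn_index; apply: eq_bigr => s' _.
    rewrite (koornH_sum (fun m => B (block_start m + s')%N)) hornerZ.
    by rewrite [rho x * t]mulrC mulfK ?gt_eqF // -mulrA.
  move=> /(graded_free (c := fun s => S s * rho x ^+ s) size_P) /(_ s sN) /eqP.
  by rewrite mulf_eq0 expf_eq0 (gt_eqF rx) andbF orbF => /eqP.
have /(graded_free (c := C j) (size_r j))/(_ i iN) // : \sum_(l < N - j) C j l *: r j l = 0.
apply: (poly_itv_eq0 lt_alpha_beta) => x xI.
rewrite horner_sum -[RHS](S0 x xI j jN).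
by apply: eq_bigr => l _; rewrite hornerZ.
Qed.

Lemma y_jacobi_matrix_unique A B :
  y_jacobi_matrix Om h A -> y_jacobi_matrix Om h B -> A = B.
Proof.
case=> fA eA [fB eB].
apply/funext => i; apply/funext => N; apply/eqP; rewrite -subr_eq0; apply/eqP.
have [M1 hM1] := finite_support_bound (fA N).
have [M2 hM2] := finite_support_bound (fB N).
pose M := maxn i.+1 (maxn M1 M2).
have AM l : (M <= l)%N -> A l N = 0 by move=> ?; apply: hM1; lia.
have BM l : (M <= l)%N -> B l N = 0 by move=> ?; apply: hM2; lia.
apply: (@Hvec_free M (fun l => A l N - B l N)); last by lia.
move=> x y xyO; under eq_bigr do rewrite mulrBl.
rewrite sumrB -(@fsbig_nat_ord _ (fun l => A l N * h l x y)); last first.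
  by move=> l /AM ->; rewrite mul0r.
rewrite -(@fsbig_nat_ord _ (fun l => B l N * h l x y)); last first.
  by move=> l /BM ->; rewrite mul0r.
by rewrite -eA // -eB // subrr.
Qed.

End KoornwinderFunctions.

(** * Multiplication by y *)

(** The two cases for rho are treated together: u is rho itself when rho is a
    polynomial and 0 when it is a square root, which [gm_rho] expresses without
    distinguishing them; Q is rho^2 and D a bound for its degree. *)
Section KoornwinderRecurrence.
Variables (R : realType) (alpha beta gamma delta : R) (rho : R -> R) (c d : R).
Variables (Rp : R -> nat -> {poly R}) (P : nat -> {poly R}) (dl gm : nat -> R).
Variables (L : nat -> {linear {poly R} -> R^o}) (Q u : {poly R}) (D du : nat).

Local Notation r k := (Rp (kappa c d k)).
Local Notation Om := (Omega alpha beta gamma delta rho).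
Local Notation H := (koornH rho c d Rp P).
Local Notation h := (Hvec rho c d Rp P).
Local Notation raise k := (connection_entry (L k.+1) (r k) (r k.+1)).
Local Notation mult k := (mult_entry (L k) (r k) u).

Hypothesis size_r : forall k n, size (r k n) = n.+1.
Hypothesis ortho_r : forall k m n, L k (r k m * r k n) = (m == n)%:R.
Hypothesis LS : forall k f, L k.+1 f = L k (Q * f).
Hypothesis size_Q : (size Q <= D.+1)%N.
Hypothesis D_ge2 : (2 <= D)%N.
Hypothesis size_u : (size u <= du.+1)%N.
Hypothesis lt_du_D : (du < D)%N.

Let raise_eq0 k i j : (j < i)%N || (i + D < j)%N -> raise k i j = 0.
Proof.
exact: (connection_entry_eq0 (size_r k) (ortho_r k) (size_r k.+1) (ortho_r k.+1)
  (LS k) size_Q).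
Qed.

Let mult_eq0 k i j : (j + du < i)%N || (i + du < j)%N -> mult k i j = 0.
Proof. exact: (mult_entry_eq0 (size_r k) (ortho_r k) size_u). Qed.

Let raise_horner k j N x : (j < N)%N ->
  (r k j).[x] = \sum_(i < N) raise k i j * (r k.+1 i).[x].
Proof.
move=> jN; rewrite {1}(connection_expansion (size_r k) (size_r k.+1) (ortho_r k.+1) jN).
by rewrite horner_sum; apply: eq_bigr => i _; rewrite hornerZ.
Qed.

Let lower_horner k j N x : (j + D < N)%N ->
  Q.[x] * (r k.+1 j).[x] = \sum_(i < N) raise k j i * (r k i).[x].
Proof.
move=> jN; rewrite -hornerM.
rewrite (connection_transpose_expansion (size_r k) (ortho_r k) (size_r k.+1) (LS k)
  size_Q jN).
by rewrite horner_sum; apply: eq_bigr => i _; rewrite hornerZ.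
Qed.

Let mult_horner k j N x : (j + du < N)%N ->
  u.[x] * (r k j).[x] = \sum_(i < N) mult k i j * (r k i).[x].
Proof.
move=> jN; rewrite -hornerM.
rewrite {1}(mult_entry_expansion (size_r k) (ortho_r k) size_u jN).
by rewrite horner_sum; apply: eq_bigr => i _; rewrite hornerZ.
Qed.

(** The coefficient of H_v in y * H_w, for v = (m, j) and w = (n, k).  The three
    summands are the steps j = k+1, j = k-1 and j = k; the first two are exchanged
    when v and w are. *)
Definition y_entry (v w : nat * nat) : R :=
  (if v.2 == w.2.+1 then dl w.2 * raise w.2 (v.1 - v.2) (w.1 - w.2) else 0)
  + (if w.2 == v.2.+1 then dl v.2 * raise v.2 (w.1 - w.2) (v.1 - v.2) else 0)
  + (if v.2 == w.2 then gm w.2 * mult w.2 (v.1 - v.2) (w.1 - w.2) else 0).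

Lemma y_entry_sym v w : y_entry v w = y_entry w v.
Proof.
rewrite /y_entry [X in _ = X + _]addrC; congr (_ + _).
rewrite [w.2 == v.2]eq_sym; case: eqP => // ->.
by rewrite mult_entry_sym.
Qed.

Lemma y_entry_order_eq0 v w : (w.2.+1 < v.2)%N || (v.2.+1 < w.2)%N -> y_entry v w = 0.
Proof.
move=> vw; rewrite /y_entry.
rewrite (_ : (v.2 == w.2.+1) = false); last by move: vw; lia.
rewrite (_ : (w.2 == v.2.+1) = false); last by move: vw; lia.
by rewrite (_ : (v.2 == w.2) = false) ?addr0 //; move: vw; lia.
Qed.

Lemma y_entry_degree_eq0 v w : (v.2 <= v.1)%N -> (w.2 <= w.1)%N ->
  (w.1 + D <= v.1)%N || (v.1 + D <= w.1)%N -> y_entry v w = 0.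
Proof.
case: v w => [m j] [n k] /= jm kn mn; rewrite /y_entry /=.
rewrite [X in X + _ + _](_ : _ = 0); last first.
  by case: eqP => // jk; rewrite raise_eq0 ?mulr0 //; move: jk mn; lia.
rewrite [X in _ + X + _](_ : _ = 0); last first.
  by case: eqP => // jk; rewrite raise_eq0 ?mulr0 //; move: jk mn; lia.
rewrite !add0r; case: eqP => // jk.
by rewrite mult_eq0 ?mulr0 //; move: jk mn; lia.
Qed.

Definition y_matrix : imatrix R :=
  fun i N => y_entry (koorn_index i) (koorn_index N).

Lemma y_matrix_high i N :
  (block_start ((koorn_index N).1 + D) <= i)%N -> y_matrix i N = 0.
Proof.
move=> /koorn_index_large iN.
by rewrite /y_matrix y_entry_degree_eq0 ?koorn_index_le // iN.
Qed.

Lemma y_matrix_structure :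
  block_bandwidths (D - 1) (D - 1) y_matrix
  /\ (forall i j : nat, mx_bandwidths 1 1 (iblock y_matrix i j))
  /\ isymmetric y_matrix.
Proof.
split; last split.
- move=> i j ij; apply/matrixP => s t; rewrite !mxE /y_matrix.
  have [si tj] := (ltn_ord s, ltn_ord t); rewrite !ltnS in si tj.
  rewrite !koorn_index_block // y_entry_degree_eq0 //=.
  by move: ij; lia.
- move=> i j s t st; rewrite !mxE /y_matrix.
  have [si tj] := (ltn_ord s, ltn_ord t); rewrite !ltnS in si tj.
  by rewrite !koorn_index_block // y_entry_order_eq0.
- by move=> i j; rewrite /y_matrix y_entry_sym.
Qed.

Hypothesis ttr : three_term P dl gm.
Hypothesis rho2 : forall x, alpha <= x <= beta -> Q.[x] = rho x ^+ 2.
Hypothesis gm_rho : forall k x, alpha <= x <= beta -> gm k * rho x = gm k * u.[x].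

(** Summing up to a large M rather than over the exact range makes every
    expansion below a complete one; the range is cut down afterwards. *)
Lemma y_koornH_long n k M x y : (k <= n)%N -> Om (x, y) -> (n + D < M)%N ->
  y * H n k x y =
    \sum_(0 <= m < M | (k < m)%N) dl k * raise k (m - k.+1) (n - k) * H m k.+1 x y
  + (if k is k'.+1 then
       \sum_(0 <= m < M | (k' <= m)%N)
         dl k' * raise k' (n - k) (m - k') * H m k' x y
     else 0)
  + \sum_(0 <= m < M | (k <= m)%N) gm k * mult k (m - k) (n - k) * H m k x y.
Proof.
move=> kn xyO nM; have [/= xI _] := xyO.
set t := y / rho x.
have tP : t * (P k).[t] = dl k * (P k.+1).[t] + gm k * (P k).[t]
    + (if k is k'.+1 then dl k' * (P k').[t] else 0).
  have := congr1 (horner^~ t) (ttr k); rewrite hornerM hornerX => ->.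
  by rewrite !hornerD !hornerZ; case: (k) => [|k']; rewrite ?hornerZ ?horner0.
have up : \sum_(0 <= m < M | (k < m)%N) dl k * raise k (m - k.+1) (n - k) * H m k.+1 x y
    = dl k * (r k (n - k)).[x] * (rho x ^+ k.+1 * (P k.+1).[t]).
  rewrite (koornH_sum _ _ _ _ _ (fun m => dl k * raise k (m - k.+1) (n - k))) -/t.
  congr (_ * _); rewrite (@raise_horner _ _ (M - k.+1)); last by lia.
  by rewrite mulr_sumr; apply: eq_bigr => i _; rewrite addnK mulrA.
have mid : \sum_(0 <= m < M | (k <= m)%N) gm k * mult k (m - k) (n - k) * H m k x y
    = gm k * rho x * (r k (n - k)).[x] * (rho x ^+ k * (P k).[t]).
  rewrite (koornH_sum _ _ _ _ _ (fun m => gm k * mult k (m - k) (n - k))) -/t.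
  congr (_ * _); rewrite gm_rho // -mulrA (@mult_horner _ _ (M - k)); last by lia.
  by rewrite mulr_sumr; apply: eq_bigr => i _; rewrite addnK mulrA.
rewrite up mid (_ : y * H n k x y =
  (r k (n - k)).[x] * rho x ^+ k.+1 * (t * (P k).[t])); last first.
  by rewrite {1}(Omega_mul_ratio xyO) -/t /koornH -/t exprS; ring.
rewrite tP {up mid tP}; case: k kn => [|k] kn; first by rewrite expr1; ring.
have -> : \sum_(0 <= m < M | (k <= m)%N) dl k * raise k (n - k.+1) (m - k) * H m k x y
    = dl k * (rho x ^+ 2 * (r k.+1 (n - k.+1)).[x]) * (rho x ^+ k * (P k).[t]).
  rewrite (koornH_sum _ _ _ _ _ (fun m => dl k * raise k (n - k.+1) (m - k))) -/t.
  congr (_ * _); rewrite -rho2 // (@lower_horner _ _ (M - k)); last by lia.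
  by rewrite mulr_sumr; apply: eq_bigr => i _; rewrite addnK mulrA.
by rewrite !exprS; ring.
Qed.

Lemma y_koornH n k x y : (k <= n)%N -> Om (x, y) ->
  y * H n k x y =
    \sum_(n.+1 - D <= m < n.+2 | (k < m)%N)
      dl k * raise k (m - k.+1) (n - k) * H m k.+1 x y
  + (if k is k'.+1 then
       \sum_(n.-1 <= m < n + D | (k' <= m)%N)
         dl k' * raise k' (n - k) (m - k') * H m k' x y
     else 0)
  + \sum_(n - du <= m < (n + du).+1 | (k <= m)%N)
      gm k * mult k (m - k) (n - k) * H m k x y.
Proof.
move=> kn xyO; rewrite (y_koornH_long kn xyO (ltnSn (n + D))); congr (_ + _ + _).
- apply: big_nat_support => [|m km mn]; first by lia.
  by rewrite raise_eq0 ?mulr0 ?mul0r //; move: mn; lia.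
- case: k kn => // k kn; apply: big_nat_support => [|m km mn]; first by lia.
  by rewrite raise_eq0 ?mulr0 ?mul0r //; move: mn; lia.
- apply: big_nat_support => [|m km mn]; first by lia.
  by rewrite mult_eq0 ?mulr0 ?mul0r //; move: mn; lia.
Qed.

(** In the sum over complete blocks, the double sum is taken with the order j
    outside: each of the three summands of an entry then selects one value of j. *)
Lemma y_matrix_jacobi : y_jacobi_matrix Om h y_matrix.
Proof.
split=> [N|N x y xyO]; first exact: bound_finite_support (fun i => @y_matrix_high i N).
rewrite (@fsbig_nat_ord _ _ (block_start ((koorn_index N).1 + D).+1)); last first.
  move=> i Ni; rewrite y_matrix_high ?mul0r // (leq_trans _ Ni) //.
  by rewrite block_startS leq_addr.
rewrite /Hvec /y_matrix; have := koorn_index_le N.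
case: (koorn_index N) => n k /= kn.
rewrite (big_koorn_index (fun m j => y_entry (m, j) (n, k) * H m j x y)).
rewrite (y_koornH_long kn xyO (ltnSn (n + D))) /y_entry /=.
under [RHS]eq_bigr do under eq_bigr do rewrite !mulrDl.
under [RHS]eq_bigr do rewrite !big_split /=.
rewrite !big_split /=; congr (_ + _ + _).
- rewrite -[LHS](big_ord_delta (fun j => \sum_(0 <= m < (n + D).+1 | (j <= m)%N)
     dl k * raise k (m - j) (n - k) * H m j x y) (M := (n + D).+1)); last by lia.
  by apply: eq_bigr => j _; case: eqP => // _; rewrite big1 // => m _; rewrite mul0r.
- case: k kn => [|k] kn.
    by rewrite big1 // => j _; rewrite big1 // => m _; rewrite mul0r.
  rewrite -[LHS](big_ord_delta (fun j => \sum_(0 <= m < (n + D).+1 | (j <= m)%N)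
     dl j * raise j (n - k.+1) (m - j) * H m j x y) (M := (n + D).+1)); last by lia.
  apply: eq_bigr => j _; rewrite eqSS eq_sym; case: eqP => // _.
  by rewrite big1 // => m _; rewrite mul0r.
- rewrite -[LHS](big_ord_delta (fun j => \sum_(0 <= m < (n + D).+1 | (j <= m)%N)
     gm k * mult k (m - j) (n - k) * H m j x y) (M := (n + D).+1)); last by lia.
  by apply: eq_bigr => j _; case: eqP => // _; rewrite big1 // => m _; rewrite mul0r.
Qed.

End KoornwinderRecurrence.

(** * The recurrence for the Koornwinder functions *)

Lemma orthonormal_polys_linear_form (R : realType) (lo hi : R) (w : R -> R)
    (p : nat -> {poly R}) (L : {linear {poly R} -> R^o}) :
  (forall f, L f = moment lo hi w f) -> orthonormal_polys lo hi w p ->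
  (forall n, size (p n) = n.+1) /\ (forall m n, L (p m * p n) = (m == n)%:R).
Proof.
move=> LE [sp op]; split=> [n|m n]; first by case: (sp n).
rewrite LE /moment /Rintegral; under eq_integral do rewrite hornerM.
by rewrite op.
Qed.

Unset Implicit Arguments.

Theorem proposition5p2 (R : realType)
  (alpha beta gamma delta : R) (rho : R -> R)
  (eta : bool) (q : {poly R}) (deta : nat)
  (a b c d : R)
  (Rp : R -> nat -> {poly R}) (P : nat -> {poly R})
  (dl gm : nat -> R) (J : R -> imatrix R) (T : R -> R -> imatrix R)
  (h_alpha_beta : alpha < beta) (h_gamma_delta : gamma < delta)
  (h_rho_pos : forall x, alpha < x < beta -> 0 < rho x)
  (h_rho : forall x, alpha <= x <= beta ->
     rho x = if eta then Num.sqrt q.[x] else q.[x])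
  (h_q : size q = deta.+1) (h_deta : (2 + eta <= deta)%N)
  (h_eta : eta -> delta = - gamma /\ 0 < delta /\ c = d)
  (h_a : -1 < a) (h_b : -1 < b) (h_c : -1 < c) (h_d : -1 < d)
  (h_wR : forall k : nat, lebesgue_measure.-integrable `[alpha, beta]
     (fun x => (wR alpha beta rho a b (kappa c d k) x)%:E))
  (h_wP : lebesgue_measure.-integrable `[gamma, delta]
     (fun y => (wP gamma delta d c y)%:E))
  (h_W : (lebesgue_measure \x lebesgue_measure)%E.-integrable
     (Omega alpha beta gamma delta rho)
     (fun z => (wW alpha beta gamma delta rho a b c d z)%:E))
  (h_Rp : forall k : nat, orthonormal_polys alpha beta
     (wR alpha beta rho a b (kappa c d k)) (Rp (kappa c d k)))
  (h_P : orthonormal_polys gamma delta (wP gamma delta d c) P)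
  (h_PTTR : three_term P dl gm)
  (h_J : forall k : nat, jacobi_matrix (Rp (kappa c d k)) (J (kappa c d k)))
  (h_T : forall k : nat, raising_matrix
     (Rp (kappa c d k)) (Rp (kappa c d k.+1))
     (T (kappa c d k) (kappa c d k.+1))) :
  let Om := Omega alpha beta gamma delta rho in
  let Hnk := koornH rho c d Rp P in
  let D := if eta then deta else (2 * deta)%N in
  (forall (n k : nat) (x y : R), (k <= n)%N -> Om (x, y) ->
     y * Hnk n k x y =
       \sum_(n.+1 - D <= m < n.+2 | (k < m)%N)
         dl k * T (kappa c d k) (kappa c d k.+1) (m - k - 1)%N (n - k)%N
         * Hnk m k.+1 x y
     + (if k is k'.+1 then
          \sum_(n.-1 <= m < n + D | (k' <= m)%N)
            dl k' * T (kappa c d k') (kappa c d k) (n - k)%N (m + 1 - k)%N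
            * Hnk m k' x y
        else 0)
     + (if eta then 0 else
          \sum_(n - deta <= m < (n + deta).+1 | (k <= m)%N)
            gm k * ihorner q (J (kappa c d k)) (n - k)%N (m - k)%N
            * Hnk m k x y))
  /\ (exists! Jy : imatrix R, y_jacobi_matrix Om (Hvec rho c d Rp P) Jy)
  /\ (forall Jy : imatrix R, y_jacobi_matrix Om (Hvec rho c d Rp P) Jy ->
        block_bandwidths (D - 1) (D - 1) Jy
        /\ (forall i j : nat, mx_bandwidths 1 1 (iblock Jy i j))
        /\ isymmetric Jy).
Proof.
move=> Om Hnk D.
have q_gt0 x : alpha < x < beta -> q.[x] > 0.
  move=> xI; have := h_rho_pos x xI.
  rewrite h_rho; last by case/andP: xI => /ltW -> /ltW ->.
  by case: (eta) => //; rewrite sqrtr_gt0.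
(* Q is rho^2; u carries the step that keeps the order k, absent when rho is a
   square root. *)
pose Q := if eta then q else q * q; pose u := if eta then 0 else q.
pose du := if eta then 0%N else deta.
have q_neq0 : q != 0 by rewrite -size_poly_eq0 h_q.
have size_Q : (size Q <= D.+1)%N.
  rewrite /Q /D; case: (eta); rewrite ?h_q // size_mul // h_q; lia.
have D_ge2 : (2 <= D)%N by move: h_deta; rewrite /D; case: (eta) => /=; lia.
have size_u : (size u <= du.+1)%N by rewrite /u /du; case: (eta); rewrite ?size_poly0 ?h_q.
have du_D : (du < D)%N by move: h_deta; rewrite /D /du; case: (eta) => /=; lia.
have rho2 x : alpha <= x <= beta -> Q.[x] = rho x ^+ 2.
  move=> xI; rewrite h_rho // /Q; case: (eta); last by rewrite hornerM expr2.
  by rewrite sqr_sqrtr //; exact: (poly_ge0_closed_itv h_alpha_beta).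
have LR k := moment_linear_form (h_wR k).
pose L k := sval (LR k).
have LE k f : L k f = moment alpha beta (wR alpha beta rho a b (kappa c d k)) f
  by exact: (svalP (LR k)).
have on k := orthonormal_polys_linear_form (LE k) (h_Rp k).
have size_r k n := (on k).1 n; have ortho_r k m n := (on k).2 m n.
have kappaS k : kappa c d k.+1 = kappa c d k + 2%:R.
  rewrite /kappa (_ : (2 * k.+1 + 1 = 2 * k + 1 + 2)%N); last by lia.
  by rewrite (natrD _ (_ + _)) addrA.
have LS k f : L k.+1 f = L k (Q * f).
  rewrite !LE; apply: moment_mulr_weight => // x xI.
  have rx := h_rho_pos x xI.
  rewrite rho2; last by case/andP: xI => /ltW -> /ltW ->.
  rewrite /wR kappaS powRD; last by rewrite (gt_eqF rx) implybT.
  by rewrite powR_mulrn ?ltW //; ring.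
have [LP LPE] := moment_linear_form h_wP.
have [size_P ortho_P] := orthonormal_polys_linear_form LPE h_P.
have gm0 : eta -> forall k, gm k = 0.
  move=> /h_eta[dE [_ cd]] k.
  apply: (even_three_term_diag_eq0 size_P ortho_P _ h_PTTR) => f.
  have gE : gamma = - delta by rewrite dE opprK.
  rewrite !LPE gE; apply: moment_even; rewrite -?gE // => x.
  by rewrite /wP cd gE !opprK mulrC [- x + _]addrC [delta + x]addrC.
have gm_rho k x : alpha <= x <= beta -> gm k * rho x = gm k * u.[x].
  move=> xI; move: gm0; rewrite h_rho // /u.
  by case: (eta) => // /(_ isT) ->; rewrite !mul0r.
have TE k := raising_matrix_entry (ortho_r k.+1) _ _ (h_T k).
have JE k := ihorner_jacobi_entry (size_r k) (ortho_r k) (h_J k) q.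
have jY := y_matrix_jacobi gamma delta size_r ortho_r LS size_Q D_ge2 size_u du_D
  h_PTTR rho2 gm_rho.
have uniqY := y_jacobi_matrix_unique h_alpha_beta h_gamma_delta h_rho_pos size_r size_P.
split; last split.
- move=> n k x y kn xyO; rewrite /Hnk.
  rewrite (y_koornH size_r ortho_r LS size_Q D_ge2 size_u du_D h_PTTR rho2 gm_rho kn xyO).
  congr (_ + _ + _).
  + by apply: eq_bigr => m _; rewrite TE -subnDA addn1.
  + case: k kn => // k kn; apply: eq_bigr => m km.
    by rewrite TE addn1 subSS.
  + rewrite /u /du; case: (eta) gm0 => gm0.
      by rewrite big1 // => m _; rewrite gm0 // !mul0r.
    by apply: eq_bigr => m _; rewrite JE mult_entry_sym.
- by exists (y_matrix c d Rp dl gm L u); split=> // A hA; apply: uniqY hA.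
- move=> A hA; rewrite (uniqY _ _ hA jY).
  exact: (y_matrix_structure dl gm size_r ortho_r LS size_Q D_ge2 size_u du_D).
Qed.
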